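(* Let $N = p^k m^2$ be an odd perfect number given in Eulerian form, and suppose $m^2 - p^k = 2^r t$ where $r \geq 2$ is an integer and $t$ is a positive integer with $\gcd(2,t) = 1$. (1) If $m > t > 2^r$, then $m < p^k$. (2) If $m > 2^r > t$, then $m < p^k$.
   Context: A positive integer $N$ is an odd perfect number if $N$ is odd and $\sigma(N) = 2N$, where $\sigma$ denotes the sum-of-divisors function. An odd perfect number is said to be given in Eulerian form $N = p^k m^2$ if $p$ is a prime (the special prime), $k$ and $m$ are positive integers, $p \equiv k \equiv 1 \pmod 4$, and $\gcd(p,m) = 1$. *)

(* Defs.v *)
From mathcomp Require Import all_boot all_order all_algebra.

Set Implicit Arguments.
Unset Strict Implicit.
Unset Printing Implicit Defensive.

Definition sigma (n : nat) : nat := \sum_(d <- divisors n) d.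

Definition odd_perfect (N : nat) : Prop :=
  [/\ 0 < N, odd N & sigma N = 2 * N].

Definition eulerian_form (N p k m : nat) : Prop :=
  N = p ^ k * m ^ 2 /\
  [/\ prime p, 0 < k, 0 < m,
      p = k %[mod 4] /\ k = 1 %[mod 4] & gcdn p m = 1].

(* Main.v *)
Require Import Defs.
From mathcomp Require Import all_boot all_order all_algebra zify.

(** Both parts are one size estimate: [2 ^ r] and [t] are distinct positive integers below [m], so
    their product falls short of [m ^ 2] by more than [m], and that shortfall is [p ^ k]. The parts
    differ only in which factor is smaller. *)

(* [a * b <= (m - 2) * (m - 1)], hence [q >= 3 * m - 2 > m]. *)
Lemma ltn_of_sqr_eq_addM (m q a b : nat) :
  0 < a -> a < b -> b < m -> m ^ 2 = q + a * b -> m < q.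
Proof. by move=> a_gt0 ab bm; rewrite -mulnn => E; nia. Qed.

Theorem theorem4 (N p k m r t : nat)
  (hN : odd_perfect N)
  (hE : eulerian_form N p k m)
  (hr : 2 <= r)
  (ht : 0 < t)
  (h2t : gcdn 2 t = 1)
  (hrt : (m%:Z ^+ 2 - p%:Z ^+ k = 2%:Z ^+ r * t%:Z :> int)%R) :
  (2 ^ r < t -> t < m -> m < p ^ k) /\
  (t < 2 ^ r -> 2 ^ r < m -> m < p ^ k).
Proof.
(* Additive form, so that no truncated subtraction arises in [nat]. *)
have E : m ^ 2 = p ^ k + 2 ^ r * t.
  by lia.
split=> [ab bm|ab bm].
  by apply: ltn_of_sqr_eq_addM ab bm E; rewrite expn_gt0.
(* Now [t] is the smaller factor, hence the swap. *)
by apply: ltn_of_sqr_eq_addM ab bm _; rewrite // mulnC.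
Qed.
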